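(* For $\varepsilon>0$ define \[ D(\varepsilon):=\sqrt{(1+6\varepsilon)\,\frac{\sinh(2\varepsilon)-2\varepsilon}{(2\varepsilon)^2}},\qquad C(\varepsilon):=\max\Big\{\frac{4\sqrt2+D(\varepsilon)}{1-D(\varepsilon)},\ \sqrt{\frac{1+e^{-\varepsilon}}{1-e^{-\varepsilon}}}\Big\}, \] and let $C_0:=\inf\{C(\varepsilon):\varepsilon>0,\ D(\varepsilon)<1\}$. Then for every integer $n\ge1$ and every family $\eta_1,\dots,\eta_n$ of admissible measures on $\mathbb R$, \[ T\Big(\Big(\tfrac1n\sum_{i=1}^n\eta_i\Big)^{*n}\Big)\le C_0\,T(\eta_1*\cdots*\eta_n). \]
   Context: A finitely supported positive measure $\eta$ on $\mathbb R$ is called admissible if $\int e^x\,\eta(dx)=\int e^{-x}\,\eta(dx)=1$. $T(\eta):=\frac12\int_{\mathbb R}|e^x-e^{-x}|\,\eta(dx)$. $*$ denotes convolution of measures and $\eta^{*n}$ the $n$-fold self-convolution. *)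

(* Defs.v *)
From mathcomp Require Import all_boot all_order all_algebra.
From mathcomp Require Import all_classical all_reals all_analysis.
Set Implicit Arguments. Unset Strict Implicit. Unset Printing Implicit Defensive.
Import Order.TTheory GRing.Theory Num.Theory.
Local Open Scope classical_set_scope.
Local Open Scope ring_scope.

(* A finitely supported measure on R is represented by a finite list of atoms
   (w, x) meaning the measure  sum w * delta_x. *)
Definition fmeas (R : realType) := seq (R * R).

Section FM.
Variable R : realType.

Definition fm_pos (m : fmeas R) : bool := all (fun p => 0 <= p.1) m.

Definition fm_int (f : R -> R) (m : fmeas R) : R := \sum_(p <- m) p.1 * f p.2.

Definition admissible (m : fmeas R) : Prop :=
  fm_pos m /\ fm_int expR m = 1 /\ fm_int (fun x => expR (- x)) m = 1.

Definition Tfun (m : fmeas R) : R :=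
  2^-1 * fm_int (fun x => `|expR x - expR (- x)|) m.

Definition fm_conv (m1 m2 : fmeas R) : fmeas R :=
  [seq (p.1 * q.1, p.2 + q.2) | p <- m1, q <- m2].

Definition fm_dirac0 : fmeas R := [:: (1, 0)].

Definition fm_scale (c : R) (m : fmeas R) : fmeas R := [seq (c * p.1, p.2) | p <- m].

Definition fm_convpow (m : fmeas R) (n : nat) : fmeas R := iter n (fm_conv m) fm_dirac0.

Definition fm_bigconv (n : nat) (eta : 'I_n -> fmeas R) : fmeas R :=
  \big[fm_conv/fm_dirac0]_(i < n) eta i.

Definition fm_avg (n : nat) (eta : 'I_n -> fmeas R) : fmeas R :=
  fm_scale (n%:R)^-1 (\big[cat/[::]]_(i < n) eta i).

Definition sinhR (x : R) : R := (expR x - expR (- x)) / 2.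

Definition Dconst (e : R) : R :=
  Num.sqrt ((1 + 6 * e) * ((sinhR (2 * e) - 2 * e) / (2 * e) ^+ 2)).

Definition Cconst (e : R) : R :=
  Num.max ((4 * Num.sqrt 2 + Dconst e) / (1 - Dconst e))
          (Num.sqrt ((1 + expR (- e)) / (1 - expR (- e)))).

Definition C0const : R :=
  inf [set Cconst e | e in [set e : R | 0 < e /\ Dconst e < 1]].

End FM.

(* Main.v *)
Require Import Defs.
From mathcomp Require Import all_boot all_order all_algebra.
From mathcomp Require Import all_classical all_reals all_analysis.
From mathcomp Require Import ring lra.
Import Order.TTheory GRing.Theory Num.Theory.
Import numFieldNormedType.Exports.
Set Implicit Arguments. Unset Strict Implicit. Unset Printing Implicit Defensive.
Local Open Scope ring_scope.

(**
  Tilting an admissible eta by cosh turns it into a centred probability law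
  on [-1, 1] for the variable t = tanh x, and T of a convolution becomes
  E |A| with A = (prod (1 + t_i) - prod (1 - t_i)) / 2.  Put S = sum t_i and
  v = sum E t_i^2.  The remainder A - S has second moment at most sinh v - v,
  while the fourth moment of S forces v <= sqrt (1 + 3 v) E |S|, so
  E |A - S| <= D E |S| as soon as v <= 2 eps.  The value of v is the same for
  the family and for n copies of its average, and E |S| for the average is at
  most a constant times E |S| for the family: after symmetrization all
  characteristic functions are nonnegative, AM-GM compares their products, and
  |x| is comparable to a positive combination of the functions 1 - cos (t x).
  The constant obtained is 26 / 5 < 4 sqrt 2.  If v > 2 eps, the mass rho of
  the convolution is at most exp (- eps); then 1 - rho <= T <= sqrt (1 - rho^2),
  valid for all admissible measures, and AM-GM for the masses are enough.
*)

(** * Real estimates: sinh, products and the sine *)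

Section RealEstimates.
Variable R : realType.
Implicit Types x y b c : R.

Let sqn x : `|x| ^+ 2 = x ^+ 2. Proof. by rewrite real_normK ?num_real. Qed.

(** This is the exponential series with degrees 0 and 1 removed. For [0 <= x] its terms are
    nonnegative, so bounds on [sinhR x - x] can be proved term by term. *)
Lemma sinhR_sub_cvg x :
  (\sum_(0 <= i < n) (x ^+ i.+2 - (- x) ^+ i.+2) / (i.+2)`!%:R @[n --> \oo] -->
   2 * (sinhR x - x))%classic.
Proof.
have -> : 2 * (sinhR x - x) = expR x - expR (- x) - x *+ 2.
  by rewrite /sinhR -mulr_natl; lra.
pose f := (series (exp_coeff x) - series (exp_coeff (- x)) - cst (x *+ 2))%R.
have cf : (f @ \oo --> expR x - expR (- x) - x *+ 2)%classic.
  by apply: cvgB; [apply: cvgB; apply: is_cvg_series_exp_coeff|apply: cvg_cst].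
rewrite -(cvg_shiftn 2) in cf.
apply: cvg_trans cf; apply: near_eq_cvg; near=> n.
rewrite /f /series /= !fctE -sumrB addn2 !big_nat_recl//=.
rewrite /exp_coeff /= !expr0 !expr1 fact0 invr1 !mulr1 subrr add0r opprK.
rewrite -mulr2n addrAC subrr add0r; apply: eq_bigr => i _.
by rewrite mulrBl.
Unshelve. all: by end_near.
Qed.

Lemma exprB_sinh_ge0 x n : 0 <= x -> 0 <= x ^+ n - (- x) ^+ n.
Proof.
move=> x0; rewrite exprNn subr_ge0 -{2}[x ^+ _]mul1r ler_wpM2r ?exprn_ge0//.
by rewrite -signr_odd; case: odd; rewrite ?expr1 ?expr0 ?lerN10// lerN10.
Qed.

Lemma sinhR_sub_ge0 x : 0 <= x -> 0 <= sinhR x - x.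
Proof.
move=> x0; rewrite -(@pmulr_rge0 _ 2)//.
apply: (ler_cvg_to (cvg_cst 0) (@sinhR_sub_cvg x)); near=> n.
by rewrite sumr_ge0// => i _; rewrite divr_ge0// exprB_sinh_ge0.
Unshelve. all: by end_near.
Qed.

(** The term of degree [i.+2] picks up a factor l^(i+2) <= l^2. Equivalently, (sinh x - x) / x^2 is
    nondecreasing on x > 0. *)
Lemma sinhR_sub_scale l b : 0 <= l <= 1 -> 0 <= b ->
  sinhR (l * b) - l * b <= l ^+ 2 * (sinhR b - b).
Proof.
move=> /andP[l0 l1] b0; rewrite -(@ler_pM2l _ 2)// [leRHS]mulrCA.
have h := @cvgMl_tmp _ _ _ _ _ (l ^+ 2) _ (@sinhR_sub_cvg b).
apply: (ler_cvg_to (@sinhR_sub_cvg (l * b)) (h _)).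
near=> n; rewrite /= mulr_sumr ler_sum// => i _.
rewrite mulrA ler_wpM2r// -(mulrN l b) !exprMn -mulrBr.
rewrite -addn2 (exprD l) -mulrA mulrCA ler_wpM2l ?exprn_ge0//.
by rewrite ler_piMl ?exprn_ile1// exprB_sinh_ge0.
Unshelve. all: by end_near.
Qed.

Lemma sinhR_sub_le x b : 0 <= x <= b -> 0 < b ->
  sinhR x - x <= x ^+ 2 * ((sinhR b - b) / b ^+ 2).
Proof.
move=> /andP[x0 xb] b0.
have := @sinhR_sub_scale (x / b) b.
rewrite divfK ?gt_eqF// divr_ge0// ?(ltW b0)// ler_pdivrMr// mul1r xb.
by move=> /(_ isT isT); rewrite exprMn exprVn mulrAC mulrA.
Qed.

(** From exp (-1/2) >= 1/2 follows e <= 4, hence sinh 1 <= (4 - 1/4) / 2. *)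
Lemma sinhR1_sub_le : sinhR (1 : R) - 1 <= 7 / 8.
Proof.
have h : 2^-1 <= expR (- 2^-1) :> R by have := expR_ge1Dx (- 2^-1 : R); lra.
have e1 : 4^-1 <= expR (- 1) :> R.
  have -> : - 1 = - 2^-1 + - 2^-1 :> R by lra.
  by rewrite expRD; nra.
have := expRxMexpNx_1 (1 : R); rewrite /sinhR.
by have := expR_gt0 (1 : R); nra.
Qed.

(** The new sum is (p + q) + a (p - q) and the new difference (p - q) + a (p + q). Both are
    dominated through the addition formulas for cosh and sinh, because cosh a >= 1 and sinh a >=
    a. *)
Lemma expR_gap_step (v a p q : R) : 0 <= v -> 0 <= a <= 1 ->
  p + q <= expR v + expR (- v) -> p - q <= expR v - expR (- v) ->
  p * (1 + a) + q * (1 - a) <= expR (v + a) + expR (- (v + a)) /\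
  p * (1 + a) - q * (1 - a) <= expR (v + a) - expR (- (v + a)).
Proof.
move=> v0 /andP[a0 a1].
rewrite opprD !expRD.
have av := sinhR_sub_ge0 a0; have vv := sinhR_sub_ge0 v0.
rewrite /sinhR in av vv.
have aI := expRxMexpNx_1 a; have vI := expRxMexpNx_1 v.
have ap := expR_ge1Dx a; have an := expR_gt0 (- a).
have vp := expR_ge1Dx v; have vn := expR_gt0 (- v).
have ch : 2 <= expR a + expR (- a) by nra.
have chv : 2 <= expR v + expR (- v) by nra.
set A := expR a in aI ap av ch *; set A' := expR (- a) in aI an av ch *.
set V := expR v in vI vp vv chv *; set V' := expR (- v) in vI vn vv chv *.
move=> h1 h2.
have s1 : a * (p - q) <= a * (V - V') by rewrite ler_wpM2l.
have s2 : a * (p + q) <= a * (V + V') by rewrite ler_wpM2l.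
have s3 : (2 * a) * (V - V') <= (A - A') * (V - V') by rewrite ler_wpM2r; lra.
have s4 : (2 * a) * (V + V') <= (A - A') * (V + V') by rewrite ler_wpM2r; lra.
have s5 : 2 * (V - V') <= (A + A') * (V - V') by rewrite ler_wpM2r; lra.
have s6 : 2 * (V + V') <= (A + A') * (V + V') by rewrite ler_wpM2r; lra.
by split; lra.
Qed.

Lemma prod_gap_le_sinhR (I : Type) (r : seq I) (a : I -> R) :
  (forall i, 0 <= a i <= 1) ->
  2^-1 * (\prod_(i <- r) (1 + a i) - \prod_(i <- r) (1 - a i)) <=
  sinhR (\sum_(i <- r) a i).
Proof.
move=> a01; set v := \sum_(i <- r) a i.
(* The sum of the two products enters the next difference, so both are bounded in one induction. *)
suff [] : \prod_(i <- r) (1 + a i) + \prod_(i <- r) (1 - a i) <=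
    expR v + expR (- v) /\
    \prod_(i <- r) (1 + a i) - \prod_(i <- r) (1 - a i) <=
    expR v - expR (- v) by rewrite /sinhR => _; lra.
rewrite /v {v}; elim: r => [|i r [IH1 IH2]]; first by rewrite !big_nil oppr0 expR0; lra.
rewrite !big_cons (mulrC (1 + _)) (mulrC (1 - _)) (addrC (a i)).
apply: expR_gap_step => //; apply: sumr_ge0 => j _.
by case/andP: (a01 j).
Qed.

(** Two mean value steps give sin x = x cos c and |cos c| >= cos^2 c = 1 - sin^2 c >= 1 - x^2. This
    suffices for |x| <= 1; beyond that the lower bound is negative. *)
Lemma normr_sin_le x : `|sin x| <= `|x| /\ `|x| - x ^+ 2 <= `|sin x|.
Proof.
wlog x0 : x / 0 <= x => [hw|].
  have [/hw//|/ltW xn] := leP 0 x.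
  have := hw (- x); rewrite oppr_ge0 => /(_ xn).
  by rewrite sinN !normrN sqrrN.
have [c cx] : exists2 c, c \in `[0, x] & sin x - sin 0 = cos c * (x - 0).
  apply: (@MVT_segment R sin cos 0 x x0).
  by apply: continuous_subspaceT => y; exact: continuous_sin.
rewrite sin0 !subr0 => sE; rewrite sE normrM (ger0_norm x0).
have c1 : `|cos c| <= 1 by rewrite ler_norml cos_geN1 cos_le1.
split; first by rewrite ler_piMl.
have [c'] : exists2 c', c' \in `[0, c] & sin c - sin 0 = cos c' * (c - 0).
  apply: (@MVT_segment R sin cos 0 c); first by move: cx; rewrite in_itv /= => /andP[].
  by apply: continuous_subspaceT => y; exact: continuous_sin.
move: cx; rewrite !in_itv /= => /andP[c0 cx] _; rewrite sin0 !subr0 => s'E.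
have c'1 : cos c' ^+ 2 <= 1 by have := cos2Dsin2 c'; have := sqr_ge0 (sin c'); lra.
have s2 : sin c ^+ 2 <= x ^+ 2.
  rewrite s'E exprMn; have : c ^+ 2 <= x ^+ 2 by rewrite lerXn2r ?nnegrE.
  by have := sqr_ge0 c; nra.
have cc : cos c ^+ 2 <= `|cos c|.
  by rewrite -(sqn (cos c)); have := normr_ge0 (cos c); nra.
have := cos2Dsin2 c.
have := normr_ge0 (cos c).
have [x1|x1] := leP x 1; nra.
Qed.

(* A bounded stand-in for |x|: absb x - absb (2 x) / 2 is comparable to
   sin x ^ 2, so dyadic sums of sin^2 telescope to |x|. *)
Definition absb x : R := `|sin x| - 2^-1 * sin x ^+ 2.

Lemma absb_bounds x : 0 <= absb x <= 1 /\ absb x <= `|x| <= absb x + 2 * x ^+ 2.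
Proof.
have [h1 h2] := normr_sin_le x.
have s1 : `|sin x| <= 1 by rewrite ler_norml sin_geN1 sin_le1.
have s0 := normr_ge0 (sin x); have x0 := normr_ge0 x.
rewrite /absb -(sqn (sin x)); rewrite -(sqn x) in h2 *.
by split; apply/andP; split; nra.
Qed.

(** With s = |sin x| and c = |cos x|, multiplying by 1 + c turns the middle term into s^2 (s + (1 +
    c) (c^2 - 1/2)), which is [K]. The two bounds then become [L] and [U], with 3/4 = 1/2 + 1/4 and
    23/20 = 1/2 + 13/20; these are proved by squaring and using s^2 = (1 + c) (1 - c). *)
Lemma absb_double x :
  4^-1 * sin x ^+ 2 <= absb x - absb (x *+ 2) / 2 <= 13 / 20 * sin x ^+ 2.
Proof.
rewrite /absb sin_mulr2n -(mulr_natl (_ * _)) !normrM normr_nat !exprMn.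
rewrite -(sqn (sin x)) -(sqn (cos x)).
have := cos2Dsin2 x; rewrite -(sqn (sin x)) -(sqn (cos x)).
move: (normr_ge0 (sin x)) (normr_ge0 (cos x)).
set s := `|sin x|; set c := `|cos x| => s0 c0 E.
have c1 : c <= 1 by nra.
have L : (1 + c) * (3 / 4 - c ^+ 2) <= s.
  have [h|h] := leP (3 / 4 - c ^+ 2) 0; first by nra.
  rewrite -(@ler_pXn2r _ 2) ?nnegrE//; last by nra.
  rewrite exprMn; have -> : s ^+ 2 = (1 + c) * (1 - c) by nra.
  rewrite expr2 -mulrA ler_wpM2l//; first by lra.
  have cL : c <= 7 / 8 by nra.
  have cq : 0 <= 7 / 16 - 25 / 16 * c + 3 / 2 * c ^+ 2.
    by have := sqr_ge0 (c - 25 / 48); lra.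
  have c3 : 0 <= c ^+ 3 by rewrite exprn_ge0.
  suff : 0 <= 7 / 16 - 25 / 16 * c + 3 / 2 * c ^+ 2 + c ^+ 3 * (3 / 2 - c - c ^+ 2) by lra.
  have [T0|T0] := leP 0 (3 / 2 - c - c ^+ 2); first by rewrite addr_ge0// mulr_ge0.
  have c8 : 4 / 5 <= c by nra.
  have : c ^+ 3 <= 3 / 4 * c by rewrite exprSr ler_wpM2r//; lra.
  have : c ^+ 3 * (3 / 2 - c - c ^+ 2) >= c ^+ 3 * (- 8^-1) by rewrite ler_wpM2l//; lra.
  by nra.
have U : s <= (1 + c) * (23 / 20 - c ^+ 2).
  rewrite -(@ler_pXn2r _ 2) ?nnegrE//; last by nra.
  rewrite exprMn; have -> : s ^+ 2 = (1 + c) * (1 - c) by nra.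
  rewrite expr2 -mulrA ler_wpM2l//; first by lra.
  have c1' : 0 <= 1 - c by lra.
  by have := sqr_ge0 (1 - c); have := sqr_ge0 ((1 - c) * (c - 10^-1)); have := mulr_ge0 c0 c1'; nra.
have K : (1 + c) * (s - 2^-1 * s ^+ 2 - (2 * (c * s) - 2^-1 * (2 ^+ 2 * (c ^+ 2 * s ^+ 2))) / 2)
   = s ^+ 2 * (s + (1 + c) * (c ^+ 2 - 2^-1)).
  have Es : s * (s ^+ 2) = s * (1 - c ^+ 2) by rewrite -E; ring.
  by lra.
have cp : 0 < 1 + c by lra.
by apply/andP; split; rewrite -(ler_pM2l cp) K; nra.
Qed.

End RealEstimates.

(** * Integration against finitely supported measures *)

(** The atoms may have any type, because joint laws are measures on lists. *)
Definition wint {R : realType} {T : Type} (m : seq (R * T)) (f : T -> R) : R :=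
  \sum_(p <- m) p.1 * f p.2.

Definition wpos {R : realType} {T : Type} (m : seq (R * T)) : bool :=
  all (fun p => 0 <= p.1) m.

Definition wmap {R : realType} {T U : Type} (w : T -> R) (g : T -> U)
    (m : seq (R * T)) : seq (R * U) :=
  [seq (p.1 * w p.2, g p.2) | p <- m].

(** The image of the product measure under [op]: addition gives convolution, subtraction
    symmetrization, [cons] a joint law. *)
Definition wconv {R : realType} {T U V : Type} (op : T -> U -> V)
    (m1 : seq (R * T)) (m2 : seq (R * U)) : seq (R * V) :=
  [seq (p.1 * q.1, op p.2 q.2) | p <- m1, q <- m2].

Section WeightedIntegral.
Variable R : realType.

Section OneType.
Variable T : Type.
Implicit Types (m : seq (R * T)) (f g : T -> R).

Lemma eq_wint m f g : f =1 g -> wint m f = wint m g.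
Proof. by move=> fg; apply: eq_bigr => p _; rewrite fg. Qed.

Lemma wintD m f g : wint m (fun x => f x + g x) = wint m f + wint m g.
Proof. by rewrite /wint -big_split; apply: eq_bigr => p _; rewrite mulrDr. Qed.

Lemma wintZ m a f : wint m (fun x => a * f x) = a * wint m f.
Proof. by rewrite /wint mulr_sumr; apply: eq_bigr => p _; rewrite mulrCA. Qed.

Lemma wintN m f : wint m (fun x => - f x) = - wint m f.
Proof. by rewrite /wint -sumrN; apply: eq_bigr => p _; rewrite mulrN. Qed.

Lemma wintB m f g : wint m (fun x => f x - g x) = wint m f - wint m g.
Proof. by rewrite wintD wintN. Qed.

Lemma wint_cst m a : wint m (fun=> a) = a * wint m (fun=> 1).
Proof. by rewrite -wintZ; apply: eq_wint => x; rewrite mulr1. Qed.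

Lemma wint_sum (I : Type) (r : seq I) m (F : I -> T -> R) :
  wint m (fun x => \sum_(i <- r) F i x) = \sum_(i <- r) wint m (F i).
Proof.
elim: r => [|i r IH].
  by under eq_wint do rewrite big_nil; rewrite wint_cst mul0r big_nil.
by under eq_wint do rewrite big_cons; rewrite wintD IH big_cons.
Qed.

Lemma wint_cons p m f : wint (p :: m) f = p.1 * f p.2 + wint m f.
Proof. exact: big_cons. Qed.

Lemma ler_wint m f g : wpos m -> (forall x, f x <= g x) -> wint m f <= wint m g.
Proof.
elim: m => [_ _|p m IH /= /andP[p0 m0] fg]; first by rewrite /wint !big_nil.
by rewrite !wint_cons lerD ?IH// ler_wpM2l.
Qed.

Lemma wint_ge0 m f : wpos m -> (forall x, 0 <= f x) -> 0 <= wint m f.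
Proof.
by move=> m0 f0; rewrite -(mul0r (wint m (fun=> 1))) -wint_cst; exact: ler_wint.
Qed.

Lemma ler_norm_wint m f : wpos m -> `|wint m f| <= wint m (fun x => `|f x|).
Proof.
move=> m0; rewrite ler_norml -wintN !ler_wint// => x.
  by rewrite ler_norm.
by rewrite lerNl -normrN ler_norm.
Qed.

End OneType.

Lemma exchange_wint (T U : Type) (m1 : seq (R * T)) (m2 : seq (R * U)) F :
  wint m1 (fun x => wint m2 (F x)) = wint m2 (fun y => wint m1 (F^~ y)).
Proof.
rewrite /wint; under eq_bigr do rewrite mulr_sumr.
rewrite exchange_big /=; apply: eq_bigr => q _; rewrite mulr_sumr.
by apply: eq_bigr => p _; rewrite mulrCA.
Qed.

Lemma wint_conv (T U V : Type) (op : T -> U -> V) m1 m2 (f : V -> R) :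
  wint (wconv op m1 m2) f = wint m1 (fun x => wint m2 (fun y => f (op x y))).
Proof.
rewrite /wint /wconv big_allpairs_dep; apply: eq_bigr => p _.
by rewrite mulr_sumr; apply: eq_bigr => q _; rewrite mulrA.
Qed.

Lemma wint_map (T U : Type) (w : T -> R) (g : T -> U) m (f : U -> R) :
  wint (wmap w g m) f = wint m (fun x => w x * f (g x)).
Proof. by rewrite /wint /wmap big_map; apply: eq_bigr => p _; rewrite mulrA. Qed.

Lemma wpos_conv (T U V : Type) (op : T -> U -> V) (m1 : seq (R * T)) m2 :
  wpos m1 -> wpos m2 -> wpos (wconv op m1 m2).
Proof.
move=> m1p; elim: m1 m1p => [//|p m1 IH] /= /andP[p0 m1p] m2p.
rewrite /wpos all_cat; apply/andP; split; last exact: IH.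
rewrite all_map; apply: sub_all m2p => q q0 /=; exact: mulr_ge0.
Qed.

Lemma wpos_map (T U : Type) (w : T -> R) (g : T -> U) (m : seq (R * T)) :
  (forall x, 0 <= w x) -> wpos m -> wpos (wmap w g m).
Proof.
move=> w0 mp; rewrite /wpos all_map; apply: sub_all mp => p p0 /=.
exact: mulr_ge0.
Qed.

End WeightedIntegral.


(** * Convolutions and joint laws *)

Section Convolution.
Variables (R : realType) (I : Type).
Implicit Types (r : seq I) (m : I -> fmeas R).

Definition bconv r m : fmeas R := \big[@fm_conv R/fm_dirac0 R]_(i <- r) m i.

Lemma wint_dirac0 (f : R -> R) : wint (fm_dirac0 R) f = f 0.
Proof. by rewrite /wint big_seq1 mul1r. Qed.

Lemma bconv_nil m (f : R -> R) : wint (bconv nil m) f = f 0.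
Proof. by rewrite /bconv big_nil wint_dirac0. Qed.

Lemma bconv_cons i r m (f : R -> R) :
  wint (bconv (i :: r) m) f =
  wint (m i) (fun x => wint (bconv r m) (fun y => f (x + y))).
Proof. by rewrite /bconv big_cons -wint_conv. Qed.

Lemma wpos_bconv r m : (forall i, wpos (m i)) -> wpos (bconv r m).
Proof.
move=> mp; rewrite /bconv; elim/big_rec: _ => [|i x _ xp] //=; first by rewrite ler01.
exact: wpos_conv.
Qed.

Lemma wint_bconv_prod r m (f : R -> R) :
  f 0 = 1 -> (forall x y, f (x + y) = f x * f y) ->
  wint (bconv r m) f = \prod_(i <- r) wint (m i) f.
Proof.
move=> f0 fM; elim: r => [|i r IH]; first by rewrite bconv_nil big_nil.
rewrite bconv_cons big_cons -IH mulrC -wintZ; apply: eq_wint => x.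
by rewrite mulrC -wintZ; apply: eq_wint => y.
Qed.

(** The joint law of independent variables. It is kept because the products of 1 + t and 1 - t
    depend on all coordinates, not only on their sum. *)
Fixpoint prodm r m : seq (R * seq R) :=
  if r is i :: r' then wconv cons (m i) (prodm r' m) else [:: (1, [::])].

Lemma wpos_prodm r m : (forall i, wpos (m i)) -> wpos (prodm r m).
Proof.
move=> mp; elim: r => [|i r IH] /=; first by rewrite ler01.
exact: wpos_conv.
Qed.

Lemma prodm_nil m f : wint (prodm nil m) f = f [::].
Proof. by rewrite /wint /= big_seq1 mul1r. Qed.

Lemma prodm_cons i r m f : wint (prodm (i :: r) m) f =
  wint (m i) (fun x => wint (prodm r m) (fun s => f (x :: s))).
Proof. exact: wint_conv. Qed.

Lemma wint_bconv_sum r m (f : R -> R) :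
  wint (bconv r m) f = wint (prodm r m) (fun s => f (\sum_(t <- s) t)).
Proof.
elim: r f => [|i r IH] f; first by rewrite bconv_nil prodm_nil big_nil.
rewrite bconv_cons prodm_cons; apply: eq_wint => x.
by rewrite IH; apply: eq_wint => s; rewrite big_cons.
Qed.

End Convolution.

(** * Moments of sums and products of independent centred variables *)

Section Moments.
Variables (R : realType) (I : Type) (m : I -> fmeas R) (a : I -> R).
Hypothesis m_pos : forall i, wpos (m i).
Hypothesis m_mass : forall i, wint (m i) (fun=> 1) = 1.
Hypothesis m_mean : forall i, wint (m i) id = 0.
Hypothesis m_var : forall i, wint (m i) (fun t => t ^+ 2) = a i.
Hypothesis m_kurt : forall i, wint (m i) (fun t => t ^+ 4) <= a i.
Implicit Types (r : seq I) (c d : R).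

Let S (s : seq R) := \sum_(t <- s) t.
Let P c (s : seq R) := \prod_(t <- s) (1 + c * t).

Lemma moment_mass r : wint (prodm r m) (fun=> 1) = 1.
Proof.
elim: r => [|i r IH]; first by rewrite prodm_nil.
by rewrite prodm_cons IH.
Qed.

Lemma moment_mean r : wint (prodm r m) S = 0.
Proof.
elim: r => [|i r IH]; first by rewrite prodm_nil /S big_nil.
rewrite prodm_cons -[RHS](m_mean i); apply: eq_wint => x.
under eq_wint do rewrite /S big_cons.
by rewrite wintD wint_cst moment_mass IH addr0 mulr1.
Qed.

Lemma moment_var r : wint (prodm r m) (fun s => S s ^+ 2) = \sum_(i <- r) a i.
Proof.
elim: r => [|i r IH]; first by rewrite prodm_nil /S !big_nil expr0n.
rewrite prodm_cons big_cons.
transitivity (wint (m i) (fun x => x ^+ 2 + \sum_(j <- r) a j)).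
  apply: eq_wint => x.
  under eq_wint => s.
    have -> : S (x :: s) ^+ 2 = x ^+ 2 * 1 + (2 * x) * S s + S s ^+ 2.
      by rewrite /S big_cons; ring.
    over.
  by rewrite !wintD !wintZ moment_mass moment_mean IH; ring.
by rewrite wintD wint_cst m_mass m_var mulr1.
Qed.

(** Centring removes the odd cross terms, so adding a variable of variance a contributes at most a +
    6 a v. The claimed bound grows by 3 a^2 more than that. *)
Lemma moment_kurt r :
  wint (prodm r m) (fun s => S s ^+ 4) <=
  (\sum_(i <- r) a i) * (1 + 3 * \sum_(i <- r) a i).
Proof.
elim: r => [|i r IH]; first by rewrite prodm_nil /S !big_nil expr0n mul0r.
rewrite prodm_cons big_cons; move: IH; set v := \sum_(j <- r) a j => IH.
pose e3 := wint (prodm r m) (fun s => S s ^+ 3); set e4 := wint _ _ in IH.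
have -> : wint (m i) (fun x => wint (prodm r m) (fun s => S (x :: s) ^+ 4)) =
    wint (m i) (fun x => x ^+ 4 + (6 * v) * x ^+ 2 + (4 * e3) * x + e4).
  apply: eq_wint => x; under eq_wint => s.
    have -> : S (x :: s) ^+ 4 = x ^+ 4 * 1 + (4 * x ^+ 3) * S s +
        (6 * x ^+ 2) * S s ^+ 2 + (4 * x) * S s ^+ 3 + S s ^+ 4.
      by rewrite /S big_cons; ring.
    over.
  by rewrite !wintD !wintZ moment_mass moment_mean moment_var -/v -/e3 -/e4; ring.
rewrite !wintD !wintZ wint_cst m_mass m_var m_mean.
by have := m_kurt i; have := sqr_ge0 (a i); nra.
Qed.

(** The product splits over the coordinates, whose linear terms have mean zero. The values 1 and -1
    of [c] and [d] give the products in [half_gap]. *)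
Lemma moment_prod2 r c d :
  wint (prodm r m) (fun s => P c s * P d s) = \prod_(i <- r) (1 + c * d * a i).
Proof.
elim: r => [|i r IH]; first by rewrite prodm_nil /P !big_nil mulr1.
rewrite prodm_cons big_cons -IH.
set e := wint (prodm r m) _.
transitivity (wint (m i) (fun x => e * 1 + (e * (c + d)) * x + (e * (c * d)) * x ^+ 2)).
  apply: eq_wint => x; under eq_wint => s.
    have -> : P c (x :: s) * P d (x :: s) =
        (1 + (c + d) * x + c * d * x ^+ 2) * (P c s * P d s).
      by rewrite /P !big_cons; ring.
    over.
  by rewrite wintZ -/e; ring.
by rewrite !wintD !wintZ m_mass m_mean m_var; ring.
Qed.

Lemma moment_prod1 r c : wint (prodm r m) (P c) = 1.
Proof.
have P0 s : P 0 s = 1 by rewrite /P big1// => t _; rewrite mul0r addr0.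
under eq_wint => s do rewrite -[P c s]mulr1 -(P0 s).
by rewrite moment_prod2 big1// => i _; rewrite mulr0 mul0r addr0.
Qed.

(** Formally the derivative of [moment_prod2] in [d] at 0. *)
Lemma moment_prod_sum r c :
  wint (prodm r m) (fun s => P c s * S s) = c * \sum_(i <- r) a i.
Proof.
elim: r => [|i r IH]; first by rewrite prodm_nil /S !big_nil !mulr0.
rewrite prodm_cons big_cons; move: IH; set v := \sum_(j <- r) a j => IH.
transitivity (wint (m i) (fun x => (c * v) * 1 + (1 + c * (c * v)) * x + c * x ^+ 2)).
  apply: eq_wint => x; under eq_wint => s.
    have -> : P c (x :: s) * S (x :: s) =
        (x + c * x ^+ 2) * P c s + (1 + c * x) * (P c s * S s).
      by rewrite /P /S !big_cons; ring.
    over.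
  by rewrite wintD !wintZ moment_prod1 IH; ring.
by rewrite !wintD !wintZ m_mass m_mean m_var; ring.
Qed.

(** The sum of the elementary symmetric polynomials of odd degree, with linear part [S]. At t = tanh
    x it is sinh of the sum of the x, divided by the product of the cosh x. *)
Definition half_gap (s : seq R) :=
  2^-1 * (\prod_(t <- s) (1 + t) - \prod_(t <- s) (1 - t)).

Lemma moment_remainder r :
  wint (prodm r m) (fun s => (half_gap s - S s) ^+ 2) =
  2^-1 * (\prod_(i <- r) (1 + a i) - \prod_(i <- r) (1 - a i)) - \sum_(i <- r) a i.
Proof.
have gapE s : half_gap s = 2^-1 * (P 1 s - P (- 1) s).
  rewrite /half_gap /P; congr (_ * (_ - _)); apply: eq_bigr => t _; ring.
under eq_wint => s.
  have -> : (half_gap s - S s) ^+ 2 =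
    4^-1 * (P 1 s * P 1 s) + 4^-1 * (P (- 1) s * P (- 1) s)
    + (- 2^-1) * (P 1 s * P (- 1) s) + (- 1) * (P 1 s * S s)
    + P (- 1) s * S s + S s ^+ 2.
    by rewrite gapE; field.
  over.
rewrite !(wintD, wintZ) !moment_prod2 !moment_prod_sum moment_var.
rewrite mulrNN !mul1r.
have -> : \prod_(i <- r) (1 - a i) = \prod_(i <- r) (1 + - 1 * a i).
  by apply: eq_bigr => i _; rewrite mulN1r.
have -> : \prod_(i <- r) (1 + a i) = \prod_(i <- r) (1 + 1 * a i).
  by apply: eq_bigr => i _; rewrite mul1r.
by field.
Qed.

Hypothesis var_le1 : forall i, a i <= 1.

Lemma var_ge0 i : 0 <= a i.
Proof. by rewrite -m_var wint_ge0// => t; rewrite sqr_ge0. Qed.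

(* Fourth-moment method: u^4 + 2 c^3 u >= 3 c^2 u^2 for u >= 0, by AM-GM. *)
Lemma var_le_absmean r c : 0 < c -> 1 + 3 * \sum_(i <- r) a i <= c ^+ 2 ->
  \sum_(i <- r) a i <= c * wint (prodm r m) (fun s => `|S s|).
Proof.
move=> c0; set v := \sum_(i <- r) a i => vc.
have v0 : 0 <= v by apply: sumr_ge0 => i _; exact: var_ge0.
have : wint (prodm r m) (fun s => 3 * c ^+ 2 * S s ^+ 2) <=
       wint (prodm r m) (fun s => S s ^+ 4 + 2 * c ^+ 3 * `|S s|).
  apply: ler_wint; first exact: wpos_prodm.
  move=> s; have -> : S s ^+ 4 = (S s ^+ 2) ^+ 2 by ring.
  have -> : S s ^+ 2 = `|S s| ^+ 2 by rewrite real_normK ?num_real.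
  move: (normr_ge0 (S s)); set u := `|S s| => u0.
  rewrite -subr_ge0; have -> : (u ^+ 2) ^+ 2 + 2 * c ^+ 3 * u - 3 * c ^+ 2 * u ^+ 2 =
    u * (u - c) ^+ 2 * (u + 2 * c) by ring.
  by apply: mulr_ge0; [rewrite mulr_ge0 ?sqr_ge0|lra].
rewrite wintD !wintZ moment_var -/v.
have := moment_kurt r; rewrite -/v; move: (wint _ _) (wint _ _) => e4 e1.
move=> h4 h.
have h5 : v * (1 + 3 * v) <= v * c ^+ 2 by rewrite ler_wpM2l.
have c2 : 0 < c ^+ 2 by rewrite exprn_gt0.
by rewrite -(ler_pM2l c2); lra.
Qed.

(** Cauchy-Schwarz, in the form that a variance is nonnegative, reduces the first absolute moment to
    the second moment, which [prod_gap_le_sinhR] bounds. *)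
Lemma remainder_absmean r k : 0 <= k ->
  sinhR (\sum_(i <- r) a i) - \sum_(i <- r) a i <= k ^+ 2 ->
  wint (prodm r m) (fun s => `|half_gap s - S s|) <= k.
Proof.
move=> k0 hk; have Pp := wpos_prodm r m_pos.
set e := wint _ _; have e0 : 0 <= e by exact: wint_ge0.
rewrite -(@ler_pXn2r _ 2) ?nnegrE//; apply: le_trans hk.
apply: (@le_trans _ _ (wint (prodm r m) (fun s => (half_gap s - S s) ^+ 2))); last first.
  by rewrite moment_remainder lerD2r prod_gap_le_sinhR// => i; rewrite var_ge0 var_le1.
have : 0 <= wint (prodm r m) (fun s => (`|half_gap s - S s| - e) ^+ 2).
  by apply: wint_ge0 => // s; exact: sqr_ge0.
under eq_wint => s.
  have -> : (`|half_gap s - S s| - e) ^+ 2 =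
    (half_gap s - S s) ^+ 2 + (- 2 * e) * `|half_gap s - S s| + e ^+ 2 * 1.
    by rewrite -[X in X + _ + _](real_normK (num_real _)); ring.
  over.
by rewrite !wintD !wintZ moment_mass -/e; lra.
Qed.

Lemma half_gap_absmean r k : 0 <= k ->
  sinhR (\sum_(i <- r) a i) - \sum_(i <- r) a i <= k ^+ 2 ->
  wint (prodm r m) (fun s => `|S s|) - k <=
  wint (prodm r m) (fun s => `|half_gap s|) <=
  wint (prodm r m) (fun s => `|S s|) + k.
Proof.
move=> k0 /(remainder_absmean k0) hk; have Pp := wpos_prodm r m_pos.
rewrite lerBlDr; apply/andP; split; apply: le_trans (lerD (lexx _) hk);
  rewrite -wintD; apply: ler_wint => // s.
- by rewrite -[X in `|X|](subrKC (half_gap s)) -[X in _ <= _ + X]normrN opprB ler_normD.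
- by rewrite -[X in `|X|](subrKC (S s)) ler_normD.
Qed.

End Moments.

(** * Tilting by cosh and the variable tanh *)

Section Tilting.
Variable R : realType.
Implicit Types (m : fmeas R) (x : R).

Definition coshR x : R := (expR x + expR (- x)) / 2.
Definition tanhR x : R := (expR x - expR (- x)) / (expR x + expR (- x)).

Definition tilt m : fmeas R := wmap coshR tanhR m.

Lemma coshR_gt0 x : 0 < coshR x.
Proof. by rewrite /coshR divr_gt0// addr_gt0// expR_gt0. Qed.

Lemma coshR_tanhR x : coshR x * (1 + tanhR x) = expR x /\
  coshR x * (1 - tanhR x) = expR (- x).
Proof.
have h : expR x + expR (- x) != 0 by rewrite gt_eqF// addr_gt0// expR_gt0.
by rewrite /coshR /tanhR; split; field.
Qed.

Lemma tanhR_sqr_le1 x : tanhR x ^+ 2 <= 1.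
Proof.
have [h1 h2] := coshR_tanhR x; have c0 := coshR_gt0 x.
have t1 : 0 < 1 + tanhR x by rewrite -(pmulr_rgt0 _ c0) h1 expR_gt0.
have t2 : 0 < 1 - tanhR x by rewrite -(pmulr_rgt0 _ c0) h2 expR_gt0.
by nra.
Qed.

Lemma wpos_tilt m : wpos m -> wpos (tilt m).
Proof. by apply: wpos_map => x; exact/ltW/coshR_gt0. Qed.

Lemma tilt_mass m : admissible m -> wint (tilt m) (fun=> 1) = 1.
Proof.
move=> [_ [h1 h2]]; rewrite wint_map.
have h1' : wint m expR = 1 := h1; have h2' : wint m (fun x => expR (- x)) = 1 := h2.
under eq_wint do rewrite mulr1 /coshR mulrC.
by rewrite wintZ wintD h1' h2'; field.
Qed.

Lemma tilt_mean m : admissible m -> wint (tilt m) id = 0.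
Proof.
move=> [_ [h1 h2]]; rewrite wint_map.
have h1' : wint m expR = 1 := h1; have h2' : wint m (fun x => expR (- x)) = 1 := h2.
under eq_wint => x.
  have -> : coshR x * tanhR x = 2^-1 * (expR x - expR (- x)).
    by have [<- <-] := coshR_tanhR x; field.
  over.
by rewrite wintZ wintB h1' h2' subrr mulr0.
Qed.

Definition tilt_var m : R := wint (tilt m) (fun t => t ^+ 2).

Lemma tilt_kurt m : wpos m -> wint (tilt m) (fun t => t ^+ 4) <= tilt_var m.
Proof.
move=> mp; rewrite /tilt_var !wint_map; apply: ler_wint => // x.
rewrite ler_wpM2l ?(ltW (coshR_gt0 x))//.
by have := tanhR_sqr_le1 x; have := sqr_ge0 (tanhR x); nra.
Qed.

Lemma tilt_var_le1 m : admissible m -> tilt_var m <= 1.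
Proof.
move=> ma; rewrite -(tilt_mass ma) /tilt_var !wint_map; apply: ler_wint.
  by case: ma.
by move=> x; rewrite ler_wpM2l ?(ltW (coshR_gt0 x))// tanhR_sqr_le1.
Qed.

(* sinh^2 / cosh = cosh - 1 / cosh <= 2 (cosh - 1) *)
Lemma tilt_var_le m : admissible m ->
  tilt_var m <= 2 * (1 - wint m (fun=> 1)).
Proof.
move=> ma; rewrite -[X in X - _](tilt_mass ma) /tilt_var !wint_map -wintB -wintZ.
apply: ler_wint; first by case: ma.
move=> x; have [h1 h2] := coshR_tanhR x; have c0 := coshR_gt0 x.
have : expR x * expR (- x) = 1 := expRxMexpNx_1 x.
rewrite -h1 -h2; set c := coshR x in c0 *; set t := tanhR x => ct.
have ct1 : c * (c * (1 - t ^+ 2)) = 1 by rewrite -[RHS]ct; ring.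
by rewrite -(ler_pM2l c0); nra.
Qed.

(** General coefficients [a] and [b] let the induction absorb the factors exp (x) and exp (-x) of
    the first atom; the positive density cosh x passes through the absolute value. *)
Lemma wint_gap (I : Type) (r : seq I) (eta : I -> fmeas R) (a b : R) :
  wint (bconv r eta) (fun x => `|a * expR x - b * expR (- x)|) =
  wint (prodm r (tilt \o eta))
    (fun s => `|a * \prod_(t <- s) (1 + t) - b * \prod_(t <- s) (1 - t)|).
Proof.
elim: r a b => [|i r IH] a b.
  by rewrite bconv_nil prodm_nil !big_nil oppr0 expR0.
rewrite bconv_cons prodm_cons wint_map; apply: eq_wint => x.
under eq_wint => y do rewrite opprD !expRD !mulrA.
rewrite IH -wintZ; apply: eq_wint => s.
rewrite !big_cons -[coshR x in RHS]ger0_norm ?(ltW (coshR_gt0 x))// -normrM.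
have [<- <-] := coshR_tanhR x.
by congr `|_|; ring.
Qed.

Lemma Tfun_half_gap (I : Type) (r : seq I) (eta : I -> fmeas R) :
  Tfun (bconv r eta) = wint (prodm r (tilt \o eta)) (fun s => `|half_gap s|).
Proof.
rewrite /Tfun; have -> : fm_int (fun x => `|expR x - expR (- x)|) (bconv r eta) =
   wint (bconv r eta) (fun x => `|1 * expR x - 1 * expR (- x)|).
  by apply: eq_wint => x; rewrite !mul1r.
rewrite wint_gap -wintZ; apply: eq_wint => s.
by rewrite /half_gap normrM !mul1r ger0_norm ?invr_ge0.
Qed.

End Tilting.

(** * Absolute means from characteristic functions, and symmetrization *)

Section AbsoluteValueComparison.
Variable R : realType.
Implicit Types (m : fmeas R) (x h t : R).

Lemma le_add_geometric (X Y C : R) :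
  0 <= C -> (forall K, X <= Y + C / 2 ^+ K) -> X <= Y.
Proof.
move=> C0 H; apply/ler_addgt0Pr => e e0.
have Ce : 0 <= C / e by rewrite divr_ge0// ltW.
set N := Num.bound (C / e); apply: (le_trans (H N)); rewrite lerD2l.
rewrite ler_pdivrMr ?exprn_gt0// mulrC -ler_pdivrMr//.
apply: (le_trans (ltW (archi_boundP Ce))).
by rewrite -natrX ler_nat ltnW// ltn_expl.
Qed.

(** A dyadic discretization of the integral of sin^2 (t x) / t^2 over t > 0, which is a multiple of
    |x|. *)
Definition trig_sum h N x : R :=
  \sum_(j < N) (2 ^+ j * h)^-1 * sin (2 ^+ j * h * x) ^+ 2.

Lemma absb_telescope h N x : 0 < h ->
  4^-1 * trig_sum h N x <=
    h^-1 * absb (h * x) - (2 ^+ N * h)^-1 * absb (2 ^+ N * h * x) <=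
  13 / 20 * trig_sum h N x.
Proof.
move=> h0; elim: N => [|N /andP[IH1 IH2]].
  by rewrite /trig_sum big_ord0 !expr0 !mul1r subrr !mulr0 lexx.
rewrite /trig_sum big_ord_recr /= -/(trig_sum h N x).
set q := 2 ^+ N * h in IH1 IH2 *.
have q0 : 0 < q^-1 by rewrite invr_gt0 mulr_gt0// exprn_gt0.
have -> : 2 ^+ N.+1 * h = 2 * q by rewrite exprS mulrA.
rewrite (invfM 2 q); have -> : 2 * q * x = (q * x) *+ 2 by rewrite -[RHS]mulr_natl mulrA.
have /andP[d1 d2] := absb_double (q * x).
have := ler_wpM2l (ltW q0) d1; have := ler_wpM2l (ltW q0) d2.
by move=> e2 e1; apply/andP; split; lra.
Qed.

(** The two errors are the ends of the telescoping sum: [absb] is at most 1 at the coarsest scale,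
    and differs from |h x| by at most 2 (h x)^2 at the finest. *)
Lemma normr_trig_sum h N x : 0 < h ->
  4^-1 * trig_sum h N x <= `|x| /\
  `|x| <= 13 / 20 * trig_sum h N x + (2 ^+ N * h)^-1 + 2 * h * x ^+ 2.
Proof.
move=> h0; have /andP[t1 t2] := absb_telescope N x h0.
have [_ /andP[b1 b2]] := absb_bounds (h * x).
have [/andP[b3 b4] _] := absb_bounds (2 ^+ N * h * x).
have q0 : 0 < (2 ^+ N * h)^-1 by rewrite invr_gt0 mulr_gt0// exprn_gt0.
have p1 := mulr_ge0 (ltW q0) b3.
have p2 : (2 ^+ N * h)^-1 * absb (2 ^+ N * h * x) <= (2 ^+ N * h)^-1.
  by rewrite ler_piMr// ltW.
have xE : `|x| = h^-1 * `|h * x|.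
  by rewrite normrM gtr0_norm// mulrA mulVf ?gt_eqF// mul1r.
have hV : 0 < h^-1 by rewrite invr_gt0.
have c1 : h^-1 * absb (h * x) <= `|x| by rewrite xE ler_pM2l.
have c2 : `|x| <= h^-1 * absb (h * x) + 2 * h * x ^+ 2.
  rewrite xE; apply: (@le_trans _ _ (h^-1 * (absb (h * x) + 2 * (h * x) ^+ 2))).
    by rewrite ler_pM2l.
  by rewrite le_eqVlt; apply/orP; left; apply/eqP; field; rewrite gt_eqF.
by split; lra.
Qed.

(* [|x|] is, up to the factor 13/5 and a vanishing error, a positive
   combination of the functions [sin (t x) ^ 2]. *)
Lemma absmean_le_of_trig (m1 m2 : fmeas R) : wpos m1 -> wpos m2 ->
  wint m1 (fun=> 1) <= 1 ->
  (forall t, wint m1 (fun x => sin (t * x) ^+ 2) <=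
             wint m2 (fun x => sin (t * x) ^+ 2)) ->
  wint m1 (fun x => `|x|) <= 13 / 5 * wint m2 (fun x => `|x|).
Proof.
move=> m1p m2p mass H.
apply: (@le_add_geometric _ _ (1 + 2 * wint m1 (fun x => x ^+ 2))) => [|K].
  by rewrite addr_ge0// mulr_ge0// wint_ge0// => x; exact: sqr_ge0.
(* Spacing 2^(-K) with 2K scales makes both errors of order 2^(-K). The factor 13/5 is the ratio of
   13/20 to 1/4. *)
have h0 : 0 < (2 ^+ K)^-1 :> R by rewrite invr_gt0 exprn_gt0.
set h := (2 ^+ K)^-1 in h0.
have qE : (2 ^+ (K + K) * h)^-1 = h.
  by rewrite exprD /h mulfK// gt_eqF// exprn_gt0.
have u : wint m1 (fun x => `|x|) <=
    wint m1 (fun x => 13 / 20 * trig_sum h (K + K) x + h * 1 + (2 * h) * x ^+ 2).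
  apply: ler_wint => // x; have [_] := normr_trig_sum (K + K) x h0.
  by rewrite qE mulr1.
have l : wint m2 (fun x => 4^-1 * trig_sum h (K + K) x) <= wint m2 (fun x => `|x|).
  by apply: ler_wint => // x; have [] := normr_trig_sum (K + K) x h0.
have c : wint m1 (trig_sum h (K + K)) <= wint m2 (trig_sum h (K + K)).
  rewrite !wint_sum; apply: ler_sum => j _; rewrite !wintZ ler_wpM2l//.
  by rewrite invr_ge0 mulr_ge0 ?exprn_ge0// ltW.
move: u l; rewrite !wintD !wintZ => u l.
have : h * wint m1 (fun=> 1) <= h by rewrite ler_piMr// ltW.
rewrite -/h; lra.
Qed.

Definition symm m : fmeas R := wconv (fun x y => x - y) m m.

Lemma wpos_symm m : wpos m -> wpos (symm m).
Proof. by move=> mp; exact: wpos_conv. Qed.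

Lemma symm_mass m : wint m (fun=> 1) = 1 -> wint (symm m) (fun=> 1) = 1.
Proof. by move=> m1; rewrite wint_conv; under eq_wint do rewrite m1. Qed.

(** The characteristic function of a difference of two independent copies is the squared modulus C^2
    + S^2. *)
Lemma symm_cos_ge0 m t : 0 <= wint (symm m) (fun x => cos (t * x)).
Proof.
rewrite wint_conv.
set C := wint m (fun x => cos (t * x)); set S := wint m (fun x => sin (t * x)).
have -> : wint m (fun x => wint m (fun y => cos (t * (x - y)))) =
    wint m (fun x => C * cos (t * x) + S * sin (t * x)).
  apply: eq_wint => x; under eq_wint => y do rewrite mulrBr cosB.
  by rewrite wintD !wintZ mulrC [_ * S]mulrC.
by rewrite wintD !wintZ addr_ge0// -expr2 sqr_ge0.
Qed.

Lemma symm_sin m t : wint (symm m) (fun x => sin (t * x)) = 0.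
Proof.
rewrite wint_conv; set J := LHS.
have : J = - J.
  rewrite {1}/J exchange_wint -wintN; apply: eq_wint => x.
  rewrite -wintN; apply: eq_wint => y.
  by rewrite -sinN -mulrN opprB.
by lra.
Qed.

(** Jensen's inequality: subtracting an independent centred copy can only increase a convex mean. *)
Lemma ler_wint_symm m a : wpos m -> wint m (fun=> 1) = 1 -> wint m id = 0 ->
  wint m (fun x => `|x + a|) <= wint (symm m) (fun x => `|x + a|).
Proof.
move=> mp m1 m0; rewrite wint_conv; apply: ler_wint => // x.
have -> : x + a = wint m (fun y => x - y + a).
  under eq_wint => y.
    have -> : x - y + a = (x + a) * 1 - y by ring.
    over.
  by rewrite wintB wintZ m1 m0 mulr1 subr0.
exact: ler_norm_wint.
Qed.

Section Families.
Variable I : Type.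
Implicit Types r : seq I.

(** Vanishing sine integrals make the characteristic functions real, so they multiply as cosines
    alone. *)
Lemma bconv_trig r (m : I -> fmeas R) t :
  (forall i, wint (m i) (fun x => sin (t * x)) = 0) ->
  wint (bconv r m) (fun x => sin (t * x)) = 0 /\
  wint (bconv r m) (fun x => cos (t * x)) =
    \prod_(i <- r) wint (m i) (fun x => cos (t * x)).
Proof.
move=> ms; elim: r => [|i r [IHs IHc]].
  by rewrite !bconv_nil big_nil mulr0 sin0 cos0.
rewrite !bconv_cons big_cons -IHc; split.
  transitivity (wint (m i) (fun x => wint (bconv r m) (fun y => cos (t * y)) * sin (t * x))).
    apply: eq_wint => x; under eq_wint => y.
      have -> : sin (t * (x + y)) = sin (t * x) * cos (t * y) + cos (t * x) * sin (t * y).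
        by rewrite mulrDr sinD.
      over.
    by rewrite wintD !wintZ IHs mulr0 addr0 mulrC.
  by rewrite wintZ ms mulr0.
rewrite [RHS]mulrC -wintZ; apply: eq_wint => x; under eq_wint => y.
  have -> : cos (t * (x + y)) = cos (t * x) * cos (t * y) - sin (t * x) * sin (t * y).
    by rewrite mulrDr cosD.
  over.
by rewrite wintB !wintZ IHs mulr0 subr0 mulrC.
Qed.

(** Factors are replaced one at a time. The shift [a] is needed because the other summands act as a
    shift on the one being replaced. *)
Lemma bconv_abs_mono r (m m' : I -> fmeas R) :
  (forall i, wpos (m i)) -> (forall i, wpos (m' i)) ->
  (forall i a, wint (m i) (fun x => `|x + a|) <= wint (m' i) (fun x => `|x + a|)) ->
  forall a, wint (bconv r m) (fun x => `|x + a|) <=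
            wint (bconv r m') (fun x => `|x + a|).
Proof.
move=> mp m'p H; elim: r => [|i r IH] a; first by rewrite !bconv_nil.
rewrite !bconv_cons.
apply: (@le_trans _ _ (wint (m i) (fun x => wint (bconv r m') (fun y => `|x + y + a|)))).
  apply: ler_wint => // x; have := IH (x + a).
  by under eq_wint do rewrite addrCA addrA; under [X in _ <= X -> _]eq_wint do rewrite addrCA addrA.
rewrite exchange_wint [leRHS]exchange_wint; apply: ler_wint.
  exact: wpos_bconv.
move=> y; have := H i (y + a).
by under eq_wint do rewrite addrA; under [X in _ <= X -> _]eq_wint do rewrite addrA.
Qed.

Lemma bconv_symm r (m : I -> fmeas R) (f : R -> R) :
  wint (bconv r (fun i => symm (m i))) f =
  wint (bconv r m) (fun x => wint (bconv r m) (fun y => f (x - y))).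
Proof.
elim: r f => [|i r IH] f; first by rewrite !bconv_nil subr0.
rewrite !bconv_cons wint_conv; apply: eq_wint => x.
under [LHS]eq_wint => y do rewrite IH.
rewrite [LHS]exchange_wint; apply: eq_wint => x'.
rewrite bconv_cons; apply: eq_wint => y; apply: eq_wint => y'.
by congr f; ring.
Qed.

Lemma bconv_symm_abs r (m : I -> fmeas R) : (forall i, wpos (m i)) ->
  wint (bconv r m) (fun=> 1) = 1 ->
  wint (bconv r (fun i => symm (m i))) (fun x => `|x|) <=
  2 * wint (bconv r m) (fun x => `|x|).
Proof.
move=> mp m1; rewrite bconv_symm; set M := bconv r m in m1 *.
have Mp : wpos M by exact: wpos_bconv.
set e := wint M (fun x => `|x|).
apply: (@le_trans _ _ (wint M (fun x => `|x| + e * 1))).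
  apply: ler_wint => // x.
  apply: (@le_trans _ _ (wint M (fun y => `|x| * 1 + `|y|))).
    by apply: ler_wint => // y; rewrite mulr1 ler_normB.
  by rewrite wintD wintZ m1 !mulr1.
by rewrite wintD wintZ m1 -/e; lra.
Qed.

End Families.
End AbsoluteValueComparison.

(** * Averaging a family, and the comparison of absolute means *)

Section Averages.
Variable R : realType.

Lemma AGM (n : nat) (E : 'I_n -> R) : (forall i, 0 <= E i) ->
  \prod_(i < n) E i <= (n%:R^-1 * \sum_(i < n) E i) ^+ n.
Proof.
move=> E0; have [+ _] := @leif_AGM R 'I_n predT E (fun i _ => E0 i).
by rewrite card_ord mulrC.
Qed.

Lemma wint_avg (n : nat) (eta : 'I_n -> fmeas R) (f : R -> R) :
  wint (fm_avg eta) f = n%:R^-1 * \sum_(i < n) wint (eta i) f.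
Proof.
rewrite /wint /fm_avg /fm_scale big_map /=.
under eq_bigr do rewrite -mulrA.
rewrite -mulr_sumr; congr (_ * _).
elim/big_rec2: _ => [|i y m _ <-]; first by rewrite big_nil.
by rewrite big_cat.
Qed.

Lemma wpos_avg (n : nat) (eta : 'I_n -> fmeas R) :
  (forall i, wpos (eta i)) -> wpos (fm_avg eta).
Proof.
move=> ep; rewrite /wpos /fm_avg all_map.
apply: (@sub_all _ (fun p : R * R => 0 <= p.1)) => [p p0 /=|].
  by rewrite mulr_ge0.
by elim/big_rec: _ => // i m _ mp; rewrite all_cat mp andbT; exact: ep.
Qed.

Lemma avg_cst (n : nat) (x : R) : (0 < n)%N ->
  n%:R^-1 * \sum_(i < n) x = x.
Proof.
move=> n0; rewrite sumr_const card_ord -(mulr_natl x) mulKf//.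
by rewrite pnatr_eq0 -lt0n.
Qed.

(** Symmetrizing the averaged side costs nothing, the characteristic function comparison costs 13/5,
    and undoing the symmetrization of the family costs 2. *)
Lemma absmean_avg (n : nat) (m : 'I_n -> fmeas R) (M : fmeas R) : (0 < n)%N ->
  (forall i, wpos (m i)) -> (forall i, wint (m i) (fun=> 1) = 1) ->
  (forall i, wint (m i) id = 0) ->
  wpos M -> (forall f, wint M f = n%:R^-1 * \sum_(i < n) wint (m i) f) ->
  wint (bconv (index_enum 'I_n) (fun=> M)) (fun x => `|x|) <=
  26 / 5 * wint (bconv (index_enum 'I_n) m) (fun x => `|x|).
Proof.
move=> n0 mp m1 m0 Mp ME; set r := index_enum _.
(* The symmetrizations are averaged, instead of symmetrizing [M], so that the characteristic
   function of [M'] is an arithmetic mean of nonnegative ones, as AM-GM requires. *)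
pose M' := fm_avg (fun i => symm (m i)).
have sp i : wpos (symm (m i)) by exact: wpos_symm.
have M'p : wpos M' by exact: wpos_avg.
have mass : wint (bconv r m) (fun=> 1) = 1.
  by rewrite wint_bconv_prod ?big1// => *; rewrite mulr1.
have step1 : wint (bconv r (fun=> M)) (fun x => `|x|) <=
    wint (bconv r (fun=> M')) (fun x => `|x|).
  have := @bconv_abs_mono R _ r (fun=> M) (fun=> M') (fun=> Mp) (fun=> M'p).
  move=> /(_ _ 0); under eq_wint do rewrite addr0.
  under [X in (_ -> _ <= X) -> _]eq_wint do rewrite addr0.
  apply=> _ a; rewrite ME wint_avg ler_wpM2l ?invr_ge0//.
  by apply: ler_sum => i _; exact: ler_wint_symm.
have step2 : wint (bconv r (fun=> M')) (fun x => `|x|) <=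
    13 / 5 * wint (bconv r (fun i => symm (m i))) (fun x => `|x|).
  have masss : wint (bconv r (fun i => symm (m i))) (fun=> 1) = 1.
    by rewrite wint_bconv_prod ?big1// => *; rewrite ?mulr1// symm_mass.
  have mass' : wint (bconv r (fun=> M')) (fun=> 1) = 1.
    rewrite wint_bconv_prod ?big1// => *; rewrite ?mulr1//.
    rewrite wint_avg; under eq_bigr do rewrite symm_mass//.
    exact: avg_cst.
  apply: absmean_le_of_trig; [exact: wpos_bconv|exact: wpos_bconv| |].
    by rewrite mass'.
  move=> t.
  have sin2E x : sin (t * x) ^+ 2 = 2^-1 * 1 - 2^-1 * cos (t *+ 2 * x).
    by rewrite mulrnAl cos_mulr2n -(mulr_natl (_ ^+ 2)); have := cos2Dsin2 (t * x); lra.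
  under eq_wint do rewrite sin2E; under [leRHS]eq_wint do rewrite sin2E.
  rewrite !wintB !wintZ mass' masss lerD2l lerN2 ler_pM2l//.
  have [|_ ->] := @bconv_trig R _ r (fun i => symm (m i)) (t *+ 2).
    by move=> i; rewrite symm_sin.
  have [|_ ->] := @bconv_trig R _ r (fun=> M') (t *+ 2).
    by move=> i; rewrite wint_avg big1 ?mulr0// => j _; rewrite symm_sin.
  rewrite prodr_const card_ord wint_avg; apply: AGM => i.
  exact: symm_cos_ge0.
have := bconv_symm_abs mp mass; lra.
Qed.

End Averages.

(** * Bounds on T by the total mass; stability of admissibility *)

Section Hellinger.
Variable R : realType.
Implicit Types (m : fmeas R).

Lemma TfunE m : Tfun m = 2^-1 * wint m (fun x => `|expR x - expR (- x)|).
Proof. by []. Qed.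

(** Integrates cosh x - 1 <= |sinh x|; admissibility gives cosh integral 1. *)
Lemma Tfun_ge_mass m : admissible m -> 1 - wint m (fun=> 1) <= Tfun m.
Proof.
move=> [mp [h1 h2]].
have h1' : wint m expR = 1 := h1; have h2' : wint m (fun x => expR (- x)) = 1 := h2.
have : wint m (fun x => 2^-1 * (expR x + expR (- x)) - 1) <=
       wint m (fun x => 2^-1 * `|expR x - expR (- x)|).
  apply: ler_wint => // x.
  have : expR x * expR (- x) = 1 := expRxMexpNx_1 x.
  have := expR_gt0 x; have := expR_gt0 (- x).
  set p := expR x; set q := expR (- x) => q0 p0 pq.
  have [pq'|pq'] := leP q p.
    by rewrite ger0_norm ?subr_ge0//; nra.
  by rewrite ltr0_norm ?subr_lt0//; nra.
rewrite wintB !wintZ wintD h1' h2' -TfunE => h.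
by apply: le_trans h; lra.
Qed.

(** Integrates 2 K |sinh x| <= K^2 (cosh x - 1) + (cosh x + 1), which is AM-GM for sinh^2 = (cosh -
    1) (cosh + 1). Optimizing [K] would give sqrt (1 - rho^2); the form kept here is affine in the
    mass. *)
Lemma Tfun_le_mass m (K : R) : admissible m -> 0 < K ->
  2 * K * Tfun m <= K ^+ 2 * (1 - wint m (fun=> 1)) + (1 + wint m (fun=> 1)).
Proof.
move=> [mp [h1 h2]] K0.
have h1' : wint m expR = 1 := h1; have h2' : wint m (fun x => expR (- x)) = 1 := h2.
have : wint m (fun x => K * `|expR x - expR (- x)|) <=
       wint m (fun x => (2^-1 * (K ^+ 2 + 1)) * (expR x + expR (- x))
                        + (1 - K ^+ 2) * 1).
  apply: ler_wint => // x.
  have : expR x * expR (- x) = 1 := expRxMexpNx_1 x.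
  have := expR_gt0 x; have := expR_gt0 (- x).
  set p := expR x; set q := expR (- x) => q0 p0 pq.
  have d2 : `|p - q| ^+ 2 = (p + q - 2) * (p + q + 2).
    by rewrite real_normK ?num_real//; nra.
  have b0 : 0 < p + q + 2 by lra.
  rewrite -(ler_pM2l b0).
  have := sqr_ge0 (K * `|p - q| - (p + q + 2)).
  rewrite sqrrB exprMn d2; lra.
rewrite wintD !wintZ wintD h1' h2'.
have -> : 2 * K * Tfun m = K * wint m (fun x => `|expR x - expR (- x)|).
  by rewrite TfunE; field.
by move=> h; apply: le_trans h _; lra.
Qed.

Lemma admissible_bconv (I : Type) (r : seq I) (eta : I -> fmeas R) :
  (forall i, admissible (eta i)) -> admissible (bconv r eta).
Proof.
move=> ea; split; last split.
- by apply: wpos_bconv => i; case: (ea i).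
- have -> : fm_int expR (bconv r eta) = \prod_(i <- r) wint (eta i) expR.
    by rewrite -wint_bconv_prod// ?expR0// => x y; rewrite expRD.
  by rewrite big1// => i _; case: (ea i) => _ [].
- have -> : fm_int (fun x => expR (- x)) (bconv r eta) =
      \prod_(i <- r) wint (eta i) (fun x => expR (- x)).
    by rewrite -wint_bconv_prod// ?oppr0 ?expR0// => x y; rewrite opprD expRD.
  by rewrite big1// => i _; case: (ea i) => _ [].
Qed.

Lemma admissible_avg (n : nat) (eta : 'I_n -> fmeas R) : (0 < n)%N ->
  (forall i, admissible (eta i)) -> admissible (fm_avg eta).
Proof.
move=> n0 ea; split; last split.
- by apply: wpos_avg => i; case: (ea i).
- rewrite [LHS](wint_avg eta expR) (eq_bigr (fun=> 1)) ?avg_cst// => i _.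
  by case: (ea i) => _ [].
- rewrite [LHS](wint_avg eta (fun x => expR (- x))) (eq_bigr (fun=> 1)) ?avg_cst// => i _.
  by case: (ea i) => _ [].
Qed.

Lemma Tfun_ge0 m : wpos m -> 0 <= Tfun m.
Proof. by move=> mp; rewrite TfunE mulr_ge0// wint_ge0. Qed.

End Hellinger.

(** * The two regimes of total mass *)

Section Comparison.
Variables (R : realType) (n : nat) (eta : 'I_n -> fmeas R).
Hypothesis n0 : (0 < n)%N.
Hypothesis ea : forall i, admissible (eta i).

Let r := index_enum 'I_n.
Let M := fm_avg eta.
Let rho i := wint (eta i) (fun=> 1).
Let T1 := Tfun (bconv r eta).
Let T2 := Tfun (bconv r (fun=> M)).

Let eta_pos i : wpos (eta i). Proof. by case: (ea i). Qed.
Let M_adm : admissible M. Proof. exact: admissible_avg. Qed.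
Let M_pos : wpos M. Proof. by case: M_adm. Qed.

Lemma mass_bconv (I : Type) (s : seq I) (m : I -> fmeas R) :
  wint (bconv s m) (fun=> 1) = \prod_(i <- s) wint (m i) (fun=> 1).
Proof. by apply: wint_bconv_prod => // *; rewrite mulr1. Qed.

Lemma Tfun_large_Hellinger (e : R) : 0 < e ->
  \prod_(i <- r) rho i <= expR (- e) ->
  T2 <= Num.sqrt ((1 + expR (- e)) / (1 - expR (- e))) * T1.
Proof.
move=> e0; set E := expR (- e); set p := \prod_(i <- r) rho i => pE.
have E0 : 0 < E := expR_gt0 _.
have E1 : 0 < 1 - E by rewrite subr_gt0 -expR0 ltr_expR oppr_lt0.
set K := Num.sqrt _.
have q1 : 0 < (1 + E) / (1 - E) by rewrite divr_gt0// addr_gt0.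
have K0 : 0 < K by rewrite sqrtr_gt0.
have K2 : K ^+ 2 * (1 - E) = 1 + E by rewrite sqr_sqrtr ?(ltW q1)// divfK// gt_eqF.
have h1 := Tfun_ge_mass (admissible_bconv r ea).
have h2 := Tfun_le_mass (admissible_bconv r (fun=> M_adm)) K0.
rewrite mass_bconv -/p -/T1 in h1.
rewrite mass_bconv -/T2 prodr_const card_ord wint_avg in h2.
have : p <= (n%:R^-1 * \sum_(i < n) wint (eta i) (fun=> 1)) ^+ n.
  by apply: AGM => i; rewrite wint_ge0.
move: (_ ^+ n) h2 => p' h2 pp'.
have K1 : 1 <= K ^+ 2 by nra.
(* The bound on [T2] decreases in the mass, so [p'] may be lowered to [p]. Then 1 + p <= 1 + E = K^2
   (1 - E) <= K^2 (1 - p), which yields T2 <= K (1 - p). *)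
have h3 : (K ^+ 2 - 1) * p <= (K ^+ 2 - 1) * p' by rewrite ler_wpM2l// subr_ge0.
have h4 : K ^+ 2 * (1 - E) <= K ^+ 2 * (1 - p) by rewrite ler_wpM2l ?sqr_ge0//; lra.
have h5 : 2 * K * T2 <= 2 * K * (K * (1 - p)) by lra.
have h6 : T2 <= K * (1 - p) by rewrite -(@ler_pM2l _ (2 * K))// mulr_gt0.
by apply: (le_trans h6); rewrite ler_pM2l.
Qed.

Lemma Tfun_small_Hellinger (e : R) : 0 < e -> Dconst e < 1 ->
  expR (- e) < \prod_(i <- r) rho i ->
  T2 <= (4 * Num.sqrt 2 + Dconst e) / (1 - Dconst e) * T1.
Proof.
move=> e0 D1 He.
set v := \sum_(i <- r) tilt_var (eta i).
have v0 : 0 <= v by apply: sumr_ge0 => i _; rewrite wint_ge0 ?wpos_tilt// => x; exact: sqr_ge0.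
have ve : v <= 2 * e.
  (* Each mass is at most exp (-(1 - rho)), so the product is at most exp of minus the sum. *)
  have hs : \sum_(i <- r) (1 - rho i) < e.
    rewrite -ltrN2 -ltr_expR; apply: (lt_le_trans He).
    rewrite -sumrN expR_sum; apply: ler_prod => i _.
    rewrite wint_ge0//=; apply: le_trans (expR_ge1Dx _); lra.
  apply: (@le_trans _ _ (\sum_(i <- r) (2 * (1 - rho i)))).
    by apply: ler_sum => i _; exact: tilt_var_le.
  by rewrite -mulr_sumr; lra.
have ME (f : R -> R) : wint (tilt M) f = n%:R^-1 * \sum_(i < n) wint (tilt (eta i)) f.
  by rewrite wint_map wint_avg; under [in RHS]eq_bigr do rewrite wint_map.
(* Tilting is linear in the measure, so the average has the average variance, and one [k] serves
   both sides. *)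
have vM : \sum_(i <- r) tilt_var M = v.
  rewrite [tilt_var M]ME sumr_const card_ord -[LHS](mulr_natl (_ * _)) mulVKf//.
  by rewrite pnatr_eq0 -lt0n.
set c := Num.sqrt (1 + 6 * e).
have c20 : 0 < 1 + 6 * e by lra.
have c0 : 0 < c by rewrite sqrtr_gt0.
have c2 : c ^+ 2 = 1 + 6 * e by rewrite sqr_sqrtr// ltW.
set D := Dconst e in D1 *.
have D0 : 0 <= D by exact: sqrtr_ge0.
have e20 : 0 < 2 * e by lra.
set g := (sinhR (2 * e) - 2 * e) / (2 * e) ^+ 2.
have g0 : 0 <= g by rewrite divr_ge0 ?sqr_ge0// sinhR_sub_ge0// ltW.
have D2 : D ^+ 2 = c ^+ 2 * g by rewrite sqr_sqrtr ?c2// mulr_ge0// ltW.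
(* Chosen so that k^2 = v^2 g, the bound on sinh v - v for v <= 2 e, while v <= c S1 turns into k <=
   D S1. *)
set k := v * D / c.
have k0 : 0 <= k by rewrite divr_ge0 ?mulr_ge0// ltW.
have vk : sinhR v - v <= k ^+ 2.
  have -> : k ^+ 2 = v ^+ 2 * g.
    by rewrite /k !exprMn exprVn D2; field; rewrite gt_eqF.
  by apply: sinhR_sub_le => //; rewrite v0 ve.
set S1 := wint (bconv r (@tilt R \o eta)) (fun x => `|x|).
set S2 := wint (bconv r (fun=> tilt M)) (fun x => `|x|).
have tp i : wpos ((@tilt R \o eta) i) by exact: wpos_tilt.
have tpM : wpos (tilt M) by exact: wpos_tilt.
have S21 : S2 <= 26 / 5 * S1.
  apply: absmean_avg => //= i; [exact: tilt_mass|exact: tilt_mean].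
have kS : k <= D * S1.
  rewrite /k mulrAC mulrC ler_wpM2l// ler_pdivrMr// mulrC /S1 wint_bconv_sum.
  apply: (@var_le_absmean R _ (@tilt R \o eta) (fun i => tilt_var (eta i))) => //=.
  - by move=> i; exact: tilt_mass.
  - by move=> i; exact: tilt_mean.
  - by move=> i; exact: tilt_kurt.
  - by rewrite -/v c2; lra.
have /andP[L1 _] : S1 - k <= T1 <= S1 + k.
  rewrite /T1 Tfun_half_gap /S1 wint_bconv_sum.
  apply: (@half_gap_absmean R _ (@tilt R \o eta) (fun i => tilt_var (eta i))) => //=.
  - by move=> i; exact: tilt_mass.
  - by move=> i; exact: tilt_mean.
  - by move=> i; exact: tilt_var_le1.
have /andP[_ L2] : S2 - k <= T2 <= S2 + k.
  rewrite /T2 Tfun_half_gap /S2 wint_bconv_sum.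
  apply: (@half_gap_absmean R _ (fun=> tilt M) (fun=> tilt_var M)) => //=.
  - by move=> i; exact: tilt_mass.
  - by move=> i; exact: tilt_mean.
  - by move=> i; exact: tilt_var_le1.
  - by rewrite vM.
have S10 : 0 <= S1 by rewrite wint_ge0// wpos_bconv.
(* Four times 13/10 is 26/5, so 4 sqrt 2 absorbs the constant of [absmean_avg]. *)
have s2 : 13 / 10 <= Num.sqrt 2 :> R.
  rewrite -(@ler_pXn2r _ 2) ?nnegrE ?sqrtr_ge0 ?divr_ge0//.
  by rewrite sqr_sqrtr//; lra.
set q := Num.sqrt 2 in s2 *.
have qS : 26 / 5 * S1 <= 4 * q * S1 by rewrite ler_wpM2r//; lra.
have D10 : 0 < 1 - D by lra.
(* What remains combines T2 <= S2 + k <= (4 q + D) S1 with (1 - D) S1 <= T1. *)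
rewrite mulrAC ler_pdivlMr//.
apply: (@le_trans _ _ ((4 * q + D) * S1 * (1 - D))).
  by rewrite ler_pM2r//; lra.
rewrite -mulrA ler_wpM2l//; first by rewrite addr_ge0// mulr_ge0// sqrtr_ge0.
by lra.
Qed.

Lemma Tfun_le_Cconst (e : R) : 0 < e -> Dconst e < 1 -> T2 <= Cconst e * T1.
Proof.
move=> e0 D1; have T10 : 0 <= T1 by rewrite Tfun_ge0// wpos_bconv.
have [h|h] := leP (\prod_(i <- r) rho i) (expR (- e)).
  apply: (le_trans (Tfun_large_Hellinger e0 h)).
  by rewrite ler_wpM2r// /Cconst le_max lexx orbT.
apply: (le_trans (Tfun_small_Hellinger e0 D1 h)).
by rewrite ler_wpM2r// /Cconst le_max lexx.
Qed.

End Comparison.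

(** * Passage to the infimum *)

(** A witness that the infimum defining [C0const] runs over a nonempty set. Here 2 e <= 1, so
    monotonicity of (sinh x - x) / x^2 and the bound at 1 give D^2 <= (11/10) (7/8) = 77/80. *)
Lemma Dconst_lt1 (R : realType) : Dconst (60^-1 : R) < 1.
Proof.
set e : R := 60^-1.
rewrite -(@ltr_pXn2r _ 2) ?nnegrE ?sqrtr_ge0// expr1n.
have e0 : 0 < 2 * e by rewrite /e; lra.
have g0 : 0 <= (sinhR (2 * e) - 2 * e) / (2 * e) ^+ 2.
  by rewrite divr_ge0 ?sqr_ge0// sinhR_sub_ge0// ltW.
rewrite sqr_sqrtr; last by rewrite mulr_ge0//; rewrite /e; lra.
have g1 : (sinhR (2 * e) - 2 * e) / (2 * e) ^+ 2 <= 7 / 8.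
  rewrite ler_pdivrMr ?exprn_gt0// [leRHS]mulrC.
  have := @sinhR_sub_le R (2 * e) 1; rewrite expr1n divr1 (ltW e0) => h.
  apply: le_trans (h _ _) _ => //; first by rewrite /e; lra.
  by rewrite ler_wpM2l ?sqr_ge0// sinhR1_sub_le.
have -> : 1 + 6 * e = 11 / 10 by rewrite /e; field.
by lra.
Qed.

Theorem theorem5 (R : realType) (n : nat) (eta : 'I_n -> fmeas R) :
  (0 < n)%N ->
  (forall i, admissible (eta i)) ->
  Tfun (fm_convpow (fm_avg eta) n) <= C0const R * Tfun (fm_bigconv eta).
Proof.
move=> n0 ea; rewrite /fm_convpow -big_const_ord.
set T2 := Tfun _; set T1 := Tfun (fm_bigconv eta).
have main (e : R) : 0 < e -> Dconst e < 1 -> T2 <= Cconst e * T1.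
  exact: Tfun_le_Cconst.
have T10 : 0 <= T1.
  by apply: Tfun_ge0; apply: wpos_bconv => i; case: (ea i).
have e0 : 0 < 60^-1 :> R by lra.
(* If [T1] vanishes, a single value of [e] already forces T2 <= 0. Otherwise T2 / T1 is a lower
   bound of all the constants, hence of their infimum. *)
have [T1z|T1n] := eqVneq T1 0.
  by have := main _ e0 (Dconst_lt1 R); rewrite T1z !mulr0.
have T1p : 0 < T1 by rewrite lt_def T1n.
rewrite -ler_pdivrMr//; apply: lb_le_inf.
  by exists (Cconst (60^-1 : R)), 60^-1 => //; split => //; exact: Dconst_lt1.
by move=> _ [e [e1 D1] <-]; rewrite ler_pdivrMr//; exact: main.
Qed.
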